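(* The adjunction $\mathcal{O}\dashv\mathrm{pt}$ between the full subcategory of $\mathbf{OrdTop}$ on ordered spaces with open cones and enough points and the full subcategory of $\mathbf{OrdLoc}$ on ordered locales satisfying (P) (with unit $\eta$ and counit $\varepsilon$) restricts to an equivalence of categories between the full subcategory of $\mathbf{OrdLoc}$ on the spatial ordered locales satisfying (P), and the full subcategory of $\mathbf{OrdTop}_{\mathrm{OC}}$ on the sober $T_0$-ordered spaces.
   Context: Ordered spaces. A preorder is a reflexive transitive relation. An ordered space is a topological space $S$ with a preorder $\le$ on its underlying set (no compatibility assumed). $\mathbf{OrdTop}$ is the category of ordered spaces and continuous monotone functions. For $A\subseteq S$ put ${\uparrow}A=\{y\mid\exists x\in A: x\le y\}$ and ${\downarrow}A=\{x\mid\exists y\in A: x\le y\}$. $S$ has open cones if ${\uparrow}U$ and ${\downarrow}U$ are open for every open $U\subseteq S$; $\mathbf{OrdTop}_{\mathrm{OC}}$ is the full subcategory of $\mathbf{OrdTop}$ on such spaces. $S$ is $T_0$-ordered if whenever $x\not\le y$, either there is an open neighbourhood $U$ of $x$ with $y\notin{\uparrow}U$, or there is an open neighbourhood $V$ of $y$ with $x\notin{\downarrow}V$. Ordered locales. A locale $X$ is given by its frame $\mathcal{O}X$ (order $\sqsubseteq$, joins $\bigvee$); a locale morphism $f\colon X\to Y$ is a frame morphism $f^{-1}\colon\mathcal{O}Y\to\mathcal{O}X$. An ordered locale is a locale $X$ with a preorder $\trianglelefteq$ on $\mathcal{O}X$ such that for every index set $I$, if $U_i\trianglelefteq V_i$ for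 all $i\in I$ then $\bigvee_i U_i\trianglelefteq\bigvee_i V_i$. A locale morphism $f\colon X\to Y$ between ordered locales is upper monotone if whenever $U\trianglelefteq U'$ in $\mathcal{O}X$ and $U\sqsubseteq f^{-1}V$ there is $V'\in\mathcal{O}Y$ with $V\trianglelefteq V'$ and $U'\sqsubseteq f^{-1}V'$; lower monotone if whenever $U\trianglelefteq U'$ and $U'\sqsubseteq f^{-1}V'$ there is $V\in\mathcal{O}Y$ with $V\trianglelefteq V'$ and $U\sqsubseteq f^{-1}V$; monotone if both. $\mathbf{OrdLoc}$ is the category of ordered locales and monotone locale morphisms. Opens. For an ordered space $S$, $\mathcal{O}S$ is the frame of open sets with the Egli-Milner preorder: $U\trianglelefteq V$ iff $U\subseteq{\downarrow}V$ and $V\subseteq{\uparrow}U$. For continuous $g\colon S\to T$, $\mathcal{O}g$ is the locale morphism with frame map $V\mapsto g^{-1}(V)$. Points. A point of a locale $X$ is a completely prime filter $\mathcal{F}\subseteq\mathcal{O}X$; $\mathrm{pt}(X)$ is the set of points with open sets $\mathrm{pt}(U)=\{\mathcal{F}\mid U\in\mathcal{F}\}$, $U\in\mathcal{O}X$, and preorder $\mathcal{F}\le\mathcal{G}$ iff ($\forall U\in\mathcal{F}\,\exists V\in\mathcal{G}: U\trianglelefteq V$) and ($\forall V\in\mathcal{G}\,\exists U\in\mathcal{F}: U\trianglelefteq V$). For a locale morphism $f\colon X\to Y$, $\mathrm{pt}(f)(\mathcal{F})=\{V\in\mathcal{O}Y\mid f^{-1}(V)\in\mathcal{F}\}$. Unit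 and counit. $\eta_S\colon S\to\mathrm{pt}(\mathcal{O}S)$ is $x\mapsto\mathcal{F}_x=\{U\in\mathcal{O}S\mid x\in U\}$; $\varepsilon_X\colon\mathcal{O}(\mathrm{pt}(X))\to X$ is the locale morphism with frame map $U\mapsto\mathrm{pt}(U)$. Conditions. $S$ has enough points if $\eta_S$ is surjective, and is sober if $\eta_S$ is bijective (equivalently, $T_0$ with enough points). An (ordered) locale $X$ is spatial if $\varepsilon_X$ is an isomorphism of locales. An ordered locale $X$ satisfies (P) if for all $U,V\in\mathcal{O}X$: $U\trianglelefteq V$ in $X$ implies $\mathrm{pt}(U)\trianglelefteq\mathrm{pt}(V)$ in $\mathcal{O}(\mathrm{pt}(X))$. *)

(* Defs.v *)
From HB Require Import structures.
From mathcomp Require Import all_boot all_order.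
From mathcomp Require Import all_classical topology_structure.
From Stdlib Require Import RelationClasses.

Set Implicit Arguments.
Unset Strict Implicit.
Unset Printing Implicit Defensive.

Import Order.TTheory.

Local Open Scope classical_set_scope.

Record category := Category {
  ob :> Type;
  hom : ob -> ob -> Type;
  idm : forall a, hom a a;
  comp : forall a b c, hom b c -> hom a b -> hom a c;
  comp1m : forall a b (f : hom a b), comp (idm b) f = f;
  compm1 : forall a b (f : hom a b), comp f (idm a) = f;
  compmA : forall a b c d (h : hom c d) (g : hom b c) (f : hom a b),
    comp h (comp g f) = comp (comp h g) f }.

Arguments hom {_} _ _.
Arguments idm {_} a.
Arguments comp {_ _ _ _} _ _.
Notation "g \oc f" := (comp g f) (at level 50, left associativity).

Definition is_iso (C : category) (a b : C) (f : hom a b) : Prop :=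
  exists g : hom b a, g \oc f = idm a /\ f \oc g = idm b.

Record functor (C D : category) := Functor {
  fob :> C -> D;
  fmor : forall a b : C, hom a b -> hom (fob a) (fob b);
  fmor1 : forall a : C, fmor (idm a) = idm (fob a);
  fmorM : forall (a b c : C) (g : hom b c) (f : hom a b),
    fmor (g \oc f) = fmor g \oc fmor f }.

Arguments fmor {_ _} _ {_ _} _.

Definition functor_id (C : category) : functor C C :=
  @Functor C C id (fun _ _ f => f) (fun _ => erefl) (fun _ _ _ _ _ => erefl).

Section FunctorComp.
Context (C D E : category) (G : functor D E) (F : functor C D).

Lemma functor_comp1 (a : C) : fmor G (fmor F (idm a)) = idm (G (F a)).
Proof. by rewrite !fmor1. Qed.

Lemma functor_compM (a b c : C) (g : hom b c) (f : hom a b) :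
  fmor G (fmor F (g \oc f)) = fmor G (fmor F g) \oc fmor G (fmor F f).
Proof. by rewrite !fmorM. Qed.

Definition functor_comp : functor C E :=
  @Functor C E (fun a => G (F a)) (fun a b f => fmor G (fmor F f))
    functor_comp1 functor_compM.
End FunctorComp.

Record nat_trans (C D : category) (F G : functor C D) := NatTrans {
  component :> forall a : C, hom (F a) (G a);
  naturality : forall (a b : C) (f : hom a b),
    component b \oc fmor F f = fmor G f \oc component a }.

Record adjunction (C D : category) (L : functor C D) (R : functor D C) :=
  Adjunction {
    adj_unit : nat_trans (functor_id C) (functor_comp R L);
    adj_counit : nat_trans (functor_comp L R) (functor_id D);
    triangleL : forall a : C, adj_counit (L a) \oc fmor L (adj_unit a) = idm (L a);
    triangleR : forall b : D, fmor R (adj_counit b) \oc adj_unit (R b) = idm (R b)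
  }.

(* An adjoint equivalence: unit and counit are natural isomorphisms. *)
Definition is_equivalence (C D : category) (L : functor C D) (R : functor D C)
    (A : adjunction L R) : Prop :=
  (forall a : C, is_iso (adj_unit A a)) /\ (forall b : D, is_iso (adj_counit A b)).

Section FullSub.
Context (C : category) (P : C -> Prop).

Definition full_sub : category :=
  @Category {a : C | P a} (fun a b => hom (sval a) (sval b))
    (fun a => idm (sval a)) (fun a b c g f => g \oc f)
    (fun a b f => comp1m f) (fun a b f => compm1 f)
    (fun a b c d h g f => compmA h g f).

Definition full_incl : functor full_sub C :=
  @Functor full_sub C (fun a => sval a) (fun a b f => f)
    (fun _ => erefl) (fun _ _ _ _ _ => erefl).

Definition full_lift (B : category) (F : functor B C) (PF : forall b : B, P (F b)) :
    functor B full_sub :=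
  @Functor B full_sub (fun b => exist P (F b) (PF b)) (fun a b f => fmor F f)
    (fun a => fmor1 F a) (fun a b c g f => fmorM F g f).
End FullSub.
Arguments full_incl : clear implicits.
Arguments full_lift C P {B} F PF.
Arguments full_sub : clear implicits.

(* Equality of arrows whose endpoints are only propositionally equal. *)
Inductive arrow_eq (C : category) (a b : C) (f : hom a b) :
    forall c d : C, hom c d -> Prop :=
  arrow_eq_refl : arrow_eq f f.

(* [A'] is obtained from [A] by restricting the two functors, the unit and the
   counit along the inclusions [I] and [J]. *)
Definition is_restriction (C D C' D' : category)
    (L : functor C D) (R : functor D C) (A : adjunction L R)
    (I : functor C' C) (J : functor D' D)
    (L' : functor C' D') (R' : functor D' C') (A' : adjunction L' R') : Prop :=
  [/\ forall (a b : C') (f : hom a b), arrow_eq (fmor J (fmor L' f)) (fmor L (fmor I f)),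
      forall (a b : D') (g : hom a b), arrow_eq (fmor I (fmor R' g)) (fmor R (fmor J g)),
      forall a : C', arrow_eq (fmor I (adj_unit A' a)) (adj_unit A (I a))
    & forall b : D', arrow_eq (fmor J (adj_counit A' b)) (adj_counit A (J b))].

Definition restricts_to_equivalence (C D C' D' : category)
    (L : functor C D) (R : functor D C) (A : adjunction L R)
    (I : functor C' C) (J : functor D' D) : Prop :=
  exists (L' : functor C' D') (R' : functor D' C') (A' : adjunction L' R'),
    is_restriction A I J A' /\ is_equivalence A'.

Record ordSpace := OrdSpace {
  os_sort :> topologicalType;
  os_le : os_sort -> os_sort -> Prop;
  os_preorder : PreOrder os_le }.

Arguments os_le {_} _ _.

Definition upset (S : ordSpace) (A : set S) : set S :=
  [set y | exists2 x, A x & os_le x y].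
Definition downset (S : ordSpace) (A : set S) : set S :=
  [set x | exists2 y, A y & os_le x y].

Definition open_cones (S : ordSpace) : Prop :=
  forall U : set S, open U -> open (upset U) /\ open (downset U).

Definition T0_ordered (S : ordSpace) : Prop :=
  forall x y : S, ~ os_le x y ->
    (exists2 U, open_nbhs x U & ~ upset U y) \/
    (exists2 V, open_nbhs y V & ~ downset V x).

Record ordMap (S T : ordSpace) := OrdMap {
  om_fun :> continuousType S T;
  om_mono : forall x y, os_le x y -> os_le (om_fun x) (om_fun y) }.

Lemma ordMap_ext (S T : ordSpace) (f g : ordMap S T) : f =1 g -> f = g.
Proof.
case: f g => [f fm] [g gm] /= /continuousEP fg.
by case: _ / fg gm => gm; rewrite (Prop_irrelevance fm gm).
Qed.

Definition ordMap_id (S : ordSpace) : ordMap S S :=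
  @OrdMap S S idfun (fun _ _ xy => xy).

Definition ordMap_comp (S T W : ordSpace) (g : ordMap T W) (f : ordMap S T) :
    ordMap S W :=
  @OrdMap S W (g \o f) (fun _ _ xy => om_mono g (om_mono f xy)).

Definition OrdTop : category.
Proof.
refine (@Category ordSpace ordMap ordMap_id (fun _ _ _ g f => ordMap_comp g f) _ _ _).
all: by move=> *; apply: ordMap_ext.
Defined.

(* Finite meets come from [TMeetSemilattice]; the bottom is [bigjoin set0]. *)
HB.mixin Record isFrame (d : Order.disp_t) T & Order.TMeetSemilattice d T := {
  bigjoin : set T -> T;
  bigjoin_leP : forall (A : set T) (x : T),
    (bigjoin A <= x)%O <-> (forall a, A a -> (a <= x)%O);
  meet_bigjoin : forall (x : T) (A : set T),
    Order.meet x (bigjoin A) = bigjoin [set Order.meet x a | a in A]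
}.

#[short(type="frameType")]
HB.structure Definition Frame (d : Order.disp_t) :=
  {T of isFrame d T & Order.TMeetSemilattice d T}.

(* The display [loc_disp] only selects notations; it carries no content. *)
Record locale := Locale {
  loc_disp : Order.disp_t;
  loc_frame :> frameType loc_disp }.

Lemma bigjoin_ub (X : locale) (A : set X) (U : X) : A U -> (U <= bigjoin A)%O.
Proof. by apply: (bigjoin_leP A (bigjoin A)).1. Qed.

(* A morphism of locales from [X] to [Y] is a frame morphism from [Y] to [X]. *)
Record locMap (X Y : locale) := LocMap {
  inv_im :> Y -> X;
  inv_imT : inv_im Order.top = Order.top;
  inv_imI : forall U V, inv_im (Order.meet U V) = Order.meet (inv_im U) (inv_im V);
  inv_imU : forall A : set Y, inv_im (bigjoin A) = bigjoin (inv_im @` A) }.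

Lemma locMap_ext (X Y : locale) (f g : locMap X Y) : f =1 g -> f = g.
Proof.
case: f g => [f fT fI fU] [g gT gI gU] /= /funext fg.
case: _ / fg gT gI gU => gT gI gU.
by rewrite (Prop_irrelevance fT gT) (Prop_irrelevance fI gI) (Prop_irrelevance fU gU).
Qed.

Lemma inv_im_le (X Y : locale) (f : locMap X Y) (U V : Y) :
  (U <= V)%O -> (f U <= f V)%O.
Proof. by move=> /meet_l <-; rewrite inv_imI leIr. Qed.

Definition locMap_id (X : locale) : locMap X X.
Proof.
refine (@LocMap X X id erefl (fun _ _ => erefl) _).
by move=> A; rewrite image_id.
Defined.

Definition locMap_comp (X Y Z : locale) (g : locMap Y Z) (f : locMap X Y) :
  locMap X Z.
Proof.
refine (@LocMap X Z (fun U => f (g U)) _ _ _).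
- by rewrite !inv_imT.
- by move=> U V; rewrite !inv_imI.
- by move=> A; rewrite !inv_imU image_comp.
Defined.

Definition Loc : category.
Proof.
refine (@Category locale locMap locMap_id (fun _ _ _ g f => locMap_comp g f) _ _ _).
all: by move=> *; apply: locMap_ext.
Defined.

Record ordLocale := OrdLocale {
  ol_locale :> locale;
  ol_le : ol_locale -> ol_locale -> Prop;
  ol_preorder : PreOrder ol_le;
  ol_bigjoin : forall (I : Type) (U V : I -> ol_locale),
    (forall i, ol_le (U i) (V i)) ->
    ol_le (bigjoin (range U)) (bigjoin (range V)) }.

Arguments ol_le {_} _ _.

Definition upper_monotone (X Y : ordLocale) (f : locMap X Y) : Prop :=
  forall (U U' : X) (V : Y), ol_le U U' -> (U <= f V)%O ->
    exists2 V' : Y, ol_le V V' & (U' <= f V')%O.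

Definition lower_monotone (X Y : ordLocale) (f : locMap X Y) : Prop :=
  forall (U U' : X) (V' : Y), ol_le U U' -> (U' <= f V')%O ->
    exists2 V : Y, ol_le V V' & (U <= f V)%O.

Record ordLocMap (X Y : ordLocale) := OrdLocMap {
  olm_map :> locMap X Y;
  olm_upper : upper_monotone olm_map;
  olm_lower : lower_monotone olm_map }.

Lemma ordLocMap_ext (X Y : ordLocale) (f g : ordLocMap X Y) : f =1 g -> f = g.
Proof.
case: f g => [f fu fl] [g gu gl] /= /locMap_ext fg.
case: _ / fg gu gl => gu gl.
by rewrite (Prop_irrelevance fu gu) (Prop_irrelevance fl gl).
Qed.

Section OrdLocaleTheory.
Context (X : ordLocale).
Implicit Types U V : X.

Lemma ol_refl U : ol_le U U.
Proof. by have [r _] := ol_preorder X; apply: r. Qed.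

Lemma ol_trans U V W : ol_le U V -> ol_le V W -> ol_le U W.
Proof. by have [_ t] := ol_preorder X; apply: t. Qed.

Lemma ol_extend V (J : Type) (W : J -> X) U' :
  (forall j, ol_le V (W j)) -> (U' <= bigjoin (range W))%O ->
  exists2 V', ol_le V V' & (U' <= V')%O.
Proof.
move=> VW UW.
exists (bigjoin (range (fun o : option J => if o is Some j then W j else V))); last first.
  apply: le_trans UW _; apply/bigjoin_leP => _ [j _ <-].
  by apply: bigjoin_ub; exists (Some j).
have {1}-> : V = bigjoin (range (fun _ : option J => V)).
  apply/le_anti/andP; split; first by apply: bigjoin_ub; exists None.
  by apply/bigjoin_leP => _ [? _ <-].
by apply: ol_bigjoin => -[j|]; [apply: VW | apply: ol_refl].
Qed.

Lemma ol_coextend V (J : Type) (W : J -> X) U' :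
  (forall j, ol_le (W j) V) -> (U' <= bigjoin (range W))%O ->
  exists2 V', ol_le V' V & (U' <= V')%O.
Proof.
move=> VW UW.
exists (bigjoin (range (fun o : option J => if o is Some j then W j else V))); last first.
  apply: le_trans UW _; apply/bigjoin_leP => _ [j _ <-].
  by apply: bigjoin_ub; exists (Some j).
have {2}-> : V = bigjoin (range (fun _ : option J => V)).
  apply/le_anti/andP; split; first by apply: bigjoin_ub; exists None.
  by apply/bigjoin_leP => _ [? _ <-].
by apply: ol_bigjoin => -[j|]; [apply: VW | apply: ol_refl].
Qed.

Lemma ol_join2 U U' V : ol_le U U' -> (U <= V)%O ->
  exists2 V', ol_le V V' & (U' <= V')%O.
Proof.
move=> UU' UV.
exists (bigjoin (range (fun b : bool => if b then U' else V))); last first.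
  by apply: bigjoin_ub; exists true.
have {1}-> : V = bigjoin (range (fun b : bool => if b then U else V)).
  apply/le_anti/andP; split; first by apply: bigjoin_ub; exists false.
  by apply/bigjoin_leP => _ [[] _ <-].
by apply: ol_bigjoin => -[] //; apply: ol_refl.
Qed.

Lemma ol_cojoin2 U U' V : ol_le U U' -> (U' <= V)%O ->
  exists2 V', ol_le V' V & (U <= V')%O.
Proof.
move=> UU' UV.
exists (bigjoin (range (fun b : bool => if b then U else V))); last first.
  by apply: bigjoin_ub; exists true.
have {2}-> : V = bigjoin (range (fun b : bool => if b then U' else V)).
  apply/le_anti/andP; split; first by apply: bigjoin_ub; exists false.
  by apply/bigjoin_leP => _ [[] _ <-].
by apply: ol_bigjoin => -[] //; apply: ol_refl.
Qed.
End OrdLocaleTheory.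

Definition ordLocMap_id (X : ordLocale) : ordLocMap X X.
Proof.
refine (@OrdLocMap X X (locMap_id X) _ _).
- by move=> U U' V; apply: ol_join2.
- by move=> U U' V; apply: ol_cojoin2.
Defined.

Definition ordLocMap_comp (X Y Z : ordLocale) (g : ordLocMap Y Z) (f : ordLocMap X Y) :
  ordLocMap X Z.
Proof.
refine (@OrdLocMap X Z (locMap_comp g f) _ _).
- move=> U U' W UU' /(olm_upper UU') [V' gV' UV'].
  have [W' WW' VW'] := olm_upper gV' (lexx _).
  by exists W' => //; apply: le_trans UV' (inv_im_le f VW').
- move=> U U' W UU' /(olm_lower UU') [V' gV' UV'].
  have [W' WW' VW'] := olm_lower gV' (lexx _).
  by exists W' => //; apply: le_trans UV' (inv_im_le f VW').
Defined.

Definition OrdLoc : category.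
Proof.
refine (@Category ordLocale ordLocMap ordLocMap_id
  (fun _ _ _ g f => ordLocMap_comp g f) _ _ _).
all: by move=> *; apply: ordLocMap_ext.
Defined.

Record opens (T : topologicalType) := Opens {
  opens_set :> set T;
  opens_open : open opens_set }.

Lemma opens_ext (T : topologicalType) (U V : opens T) : U = V :> set T -> U = V.
Proof.
case: U V => [U oU] [V oV] /= UV.
by case: _ / UV oV => oV; rewrite (Prop_irrelevance oU oV).
Qed.

HB.instance Definition _ (T : topologicalType) := gen_eqMixin (opens T).
HB.instance Definition _ (T : topologicalType) := gen_choiceMixin (opens T).

Fact opens_display : Order.disp_t. Proof. exact: Order.default_display. Qed.

Section OpensFrame.
Context (T : topologicalType).
Implicit Types U V W : opens T.

Definition opens_le U V : bool := `[< U `<=` V >].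

Lemma opens_le_refl : reflexive opens_le.
Proof. by move=> U; apply/asboolP. Qed.

Lemma opens_le_anti : antisymmetric opens_le.
Proof.
by move=> U V /andP[/asboolP UV /asboolP VU]; apply/opens_ext/seteqP.
Qed.

Lemma opens_le_trans : transitive opens_le.
Proof.
move=> V U W /asboolP UV /asboolP VW.
exact/asboolP/(subset_trans UV VW).
Qed.

HB.instance Definition _ := Order.Le_isPOrder.Build opens_display (opens T)
  opens_le_refl opens_le_anti opens_le_trans.

Lemma opens_leP U V : reflect (U `<=` V) (U <= V)%O.
Proof. exact: asboolP. Qed.

Definition opensI U V : opens T := Opens (openI (opens_open U) (opens_open V)).

Lemma opens_leI U V W : (U <= opensI V W)%O = (U <= V)%O && (U <= W)%O.
Proof.
apply/opens_leP/andP => [UVW|[/opens_leP UV /opens_leP UW] x Ux].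
  by split; apply/opens_leP => x /UVW[].
by split; [apply: UV | apply: UW].
Qed.

HB.instance Definition _ :=
  Order.POrder_isMeetSemilattice.Build opens_display (opens T) opens_leI.

Definition opensT : opens T := Opens openT.

Lemma opens_leT U : (U <= opensT)%O.
Proof. exact/opens_leP. Qed.

HB.instance Definition _ := Order.hasTop.Build opens_display (opens T) opens_leT.

Definition opens_bigjoin (A : set (opens T)) : opens T :=
  Opens (bigcup_open (fun U (_ : A U) => opens_open U)).

Lemma opens_bigjoin_leP (A : set (opens T)) U :
  (opens_bigjoin A <= U)%O <-> (forall V, A V -> (V <= U)%O).
Proof.
split=> [/opens_leP AU V AV|AU].
  by apply/opens_leP => x Vx; apply: AU; exists V.
by apply/opens_leP => x [V /AU/opens_leP]; apply.
Qed.

Lemma opens_meet_bigjoin U (A : set (opens T)) :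
  Order.meet U (opens_bigjoin A) = opens_bigjoin [set Order.meet U V | V in A].
Proof.
apply/opens_ext/seteqP; split=> x.
  by move=> [Ux [V AV Vx]]; exists (Order.meet U V) => //; exists V.
by move=> [_ [V AV <-] [Ux Vx]]; split=> //; exists V.
Qed.

HB.instance Definition _ := isFrame.Build opens_display (opens T)
  opens_bigjoin_leP opens_meet_bigjoin.
End OpensFrame.

Definition opens_loc (T : topologicalType) : locale := @Locale opens_display (opens T).

Section EgliMilner.
Context (S : ordSpace).

Definition egli_milner (U V : opens_loc S) : Prop :=
  (U : opens S) `<=` downset (V : opens S) /\ (V : opens S) `<=` upset (U : opens S).

Lemma egli_milner_preorder : PreOrder egli_milner.
Proof.
have [r t] := os_preorder S; split=> [U|U V W [UV VU] [VW WV]].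
  by split=> x Ux; exists x.
split=> x.
  move=> /UV[y /VW[z Wz yz] xy]; exists z => //; exact: t xy yz.
move=> /WV[y /VU[z Wz yz] xy]; exists z => //; exact: t yz xy.
Qed.

Lemma egli_milner_bigjoin (I : Type) (U V : I -> opens_loc S) :
  (forall i, egli_milner (U i) (V i)) ->
  egli_milner (bigjoin (range U)) (bigjoin (range V)).
Proof.
move=> UV; split=> x [_ [i _ <-]].
  by move=> /(UV i).1[y Vy xy]; exists y => //; exists (V i) => //; exists i.
by move=> /(UV i).2[y Vy xy]; exists y => //; exists (U i) => //; exists i.
Qed.

Definition opens_ol : ordLocale := OrdLocale egli_milner_preorder egli_milner_bigjoin.
End EgliMilner.

Definition opens_locMap (S T : topologicalType) (g : continuousType S T) :
  locMap (opens_loc S) (opens_loc T).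
Proof.
refine (@LocMap (opens_loc S) (opens_loc T)
  (fun V : opens T => Opens ((continuousP (g : S -> T)).1 (@cts_fun _ _ g) _ (opens_open V))) _ _ _).
- exact: opens_ext.
- by move=> U V; apply: opens_ext.
- move=> A; apply/opens_ext/seteqP; split=> x /=.
    move=> [V AV Vx]; eexists; first by exists V.
    by [].
  by move=> [_ [V AV <-] Vx]; exists V.
Defined.

Lemma os_refl (S : ordSpace) (x : S) : os_le x x.
Proof. by case: (os_preorder S). Qed.

Lemma upset_self (S : ordSpace) (U : set S) x : U x -> upset U x.
Proof. by exists x => //; apply: os_refl. Qed.

Lemma downset_self (S : ordSpace) (U : set S) x : U x -> downset U x.
Proof. by exists x => //; apply: os_refl. Qed.

Definition opens_ordLocMap (S T : ordSpace) (oT : open_cones T) (g : ordMap S T) :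
  ordLocMap (opens_ol S) (opens_ol T).
Proof.
refine (@OrdLocMap (opens_ol S) (opens_ol T) (opens_locMap g) _ _).
- move=> U U' V [_ UU'] /opens_leP UV.
  exists (Opens (oT V (opens_open V)).1 : opens T).
    by split=> [x Vx|x [y Vy yx]]; [exists x; [apply: upset_self | apply: os_refl] | exists y].
  apply/opens_leP => x /UU'[y /UV Vy yx] /=; exists (g y) => //; exact: om_mono.
- move=> U U' V [UU' _] /opens_leP UV.
  exists (Opens (oT V (opens_open V)).2 : opens T).
    by split=> [x [y Vy yx]|x Vx]; [exists y | exists x; [apply: downset_self | apply: os_refl]].
  apply/opens_leP => x /UU'[y /UV Vy yx] /=; exists (g y) => //; exact: om_mono.
Defined.

(* Completely prime filters; properness is [point_prime] for the empty set. *)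
Record loc_point (X : locale) := Point {
  point_set :> X -> Prop;
  point_T : point_set Order.top;
  point_I : forall U V, point_set U -> point_set V -> point_set (Order.meet U V);
  point_le : forall U V, (U <= V)%O -> point_set U -> point_set V;
  point_prime : forall A : set X, point_set (bigjoin A) ->
    exists2 U, A U & point_set U }.

Lemma point_ext (X : locale) (F G : loc_point X) : F = G :> (X -> Prop) -> F = G.
Proof.
case: F G => [F FT FI Fle FU] [G GT GI Gle GU] /= FG.
case: _ / FG GT GI Gle GU => GT GI Gle GU.
by rewrite (Prop_irrelevance FT GT) (Prop_irrelevance FI GI)
  (Prop_irrelevance Fle Gle) (Prop_irrelevance FU GU).
Qed.

HB.instance Definition _ (X : locale) := gen_eqMixin (loc_point X).
HB.instance Definition _ (X : locale) := gen_choiceMixin (loc_point X).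

Section PointSpace.
Context (X : locale).

Definition pt_set (U : X) : set (loc_point X) := [set F : loc_point X | F U].

Definition pt_open : set_system (loc_point X) := range pt_set.

Lemma pt_setT : pt_set Order.top = setT.
Proof. by apply/seteqP; split=> // F _; apply: point_T. Qed.

Lemma pt_setI U V : pt_set (Order.meet U V) = pt_set U `&` pt_set V.
Proof.
apply/seteqP; split=> F; last by move=> [FU FV]; apply: point_I.
by move=> FUV; split; apply: point_le FUV; rewrite ?leIl ?leIr.
Qed.

Lemma pt_setU (A : set X) : pt_set (bigjoin A) = \bigcup_(U in A) pt_set U.
Proof.
apply/seteqP; split=> F; first by move=> /point_prime[U]; exists U.
by move=> [U AU]; apply: point_le; apply: bigjoin_ub.
Qed.

Lemma pt_open_setT : pt_open setT.
Proof. by exists Order.top => //; apply: pt_setT. Qed.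

Lemma pt_open_setI : setI_closed pt_open.
Proof.
by move=> _ _ [U _ <-] [V _ <-]; exists (Order.meet U V) => //; apply: pt_setI.
Qed.

Lemma pt_open_bigcup (I : Type) (f : I -> set (loc_point X)) :
  (forall i, pt_open (f i)) -> pt_open (\bigcup_i f i).
Proof.
move=> of_; exists (bigjoin [set U | exists i, pt_set U = f i]) => //.
rewrite pt_setU; apply/seteqP; split=> F.
  by move=> [U [i Ui] FU]; exists i => //; rewrite -Ui.
by move=> [i _ Fi]; have [U _ Uf] := of_ i; exists U; [exists i | rewrite Uf].
Qed.

HB.instance Definition _ := isOpenTopological.Build (loc_point X)
  pt_open_setT pt_open_setI pt_open_bigcup.

Lemma open_pt_set (U : X) : open (pt_set U).
Proof. by exists U. Qed.

Definition pt_opens (U : X) : opens (loc_point X) := Opens (open_pt_set U).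

Lemma pt_opensP (W : opens (loc_point X)) : exists U, W = pt_opens U.
Proof.
by case: (opens_open W) => U _ UW; exists U; apply: opens_ext; rewrite -UW.
Qed.
End PointSpace.

Section PointOrder.
Context (X : ordLocale).

Definition pt_le (F G : loc_point X) : Prop :=
  (forall U, F U -> exists2 V, G V & ol_le U V) /\
  (forall V, G V -> exists2 U, F U & ol_le U V).

Lemma pt_preorder : PreOrder pt_le.
Proof.
split=> [F|F G H [FG GF] [GH HG]].
  by split=> U FU; exists U => //; apply: ol_refl.
split=> U.
  by move=> /FG[V /GH[W HW VW] UV]; exists W => //; apply: ol_trans UV VW.
by move=> /HG[V /GF[W HW VW] UV]; exists W => //; apply: ol_trans VW UV.
Qed.

Definition pt_os : ordSpace := OrdSpace pt_preorder.
End PointOrder.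

Definition pt_fun (X Y : locale) (f : locMap X Y) (F : loc_point X) : loc_point Y.
Proof.
refine (@Point Y [set V | F (f V)] _ _ _ _).
- by rewrite /= inv_imT; apply: point_T.
- by move=> U V FU FV; rewrite /= inv_imI; apply: point_I.
- by move=> U V UV; apply: point_le; apply: inv_im_le.
- by move=> A; rewrite /= inv_imU => /point_prime[_ [U AU <-]]; exists U.
Defined.

Lemma pt_fun_continuous (X Y : locale) (f : locMap X Y) : continuous (pt_fun f).
Proof. by apply/continuousP => _ [V _ <-]; exists (f V). Qed.

HB.instance Definition _ (X Y : locale) (f : locMap X Y) :=
  isContinuous.Build (loc_point X) (loc_point Y) (pt_fun f) (@pt_fun_continuous X Y f).

Definition pt_ordMap (X Y : ordLocale) (f : ordLocMap X Y) :
  ordMap (pt_os X) (pt_os Y).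
Proof.
refine (@OrdMap (pt_os X) (pt_os Y) (pt_fun f) _).
move=> F G [FG GF]; split=> V /=.
- move=> /FG[U' GU' fVU'].
  have [V' VV' U'V'] := olm_upper fVU' (lexx _).
  by exists V' => //; apply: point_le GU'.
- move=> /GF[U' GU' fVU'].
  have [V' VV' U'V'] := olm_lower fVU' (lexx _).
  by exists V' => //; apply: point_le GU'.
Defined.

Definition eta (T : topologicalType) (x : T) : loc_point (opens_loc T).
Proof.
refine (@Point (opens_loc T) [set U : opens T | (U : set T) x] _ _ _ _) => //.
by move=> U V /opens_leP; apply.
Defined.

Lemma eta_continuous (T : topologicalType) : continuous (@eta T).
Proof. by apply/continuousP => _ [U _ <-]; apply: opens_open. Qed.

HB.instance Definition _ (T : topologicalType) :=
  isContinuous.Build T (loc_point (opens_loc T)) (@eta T) (@eta_continuous T).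

Definition eta_ordMap (S : ordSpace) (oS : open_cones S) :
  ordMap S (pt_os (opens_ol S)).
Proof.
refine (@OrdMap S (pt_os (opens_ol S)) (@eta S) _).
move=> x y xy; split=> U Ux.
- exists (Opens (oS U (opens_open U)).1 : opens S); first by exists x.
  by split=> [z Uz|z [w Uw wz]]; [exists z; [apply: upset_self | apply: os_refl] | exists w].
- exists (Opens (oS U (opens_open U)).2 : opens S); first by exists y.
  by split=> [z [w Uw wz]|z Uz]; [exists w | exists z; [apply: downset_self | apply: os_refl]].
Defined.

Definition epsilon (X : locale) : locMap (opens_loc (loc_point X)) X.
Proof.
refine (@LocMap (opens_loc (loc_point X)) X (@pt_opens X) _ _ _).
- exact/opens_ext/pt_setT.
- by move=> U V; apply/opens_ext/pt_setI.
- move=> A; apply: opens_ext; rewrite /= pt_setU; apply/seteqP; split=> F.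
    by move=> [U AU FU]; exists (pt_opens U) => //; exists U.
  by move=> [_ [U AU <-] FU]; exists U.
Defined.

Definition epsilon_ordLocMap (X : ordLocale) : ordLocMap (opens_ol (pt_os X)) X.
Proof.
refine (@OrdLocMap (opens_ol (pt_os X)) X (epsilon X) _ _).
- move=> U U' V [_ UU'] /opens_leP UV.
  pose W (j : {W : X | ol_le V W}) := sval j.
  have [|V' VV' WV'] := @ol_extend X V _ W (bigjoin (range W)) _ (lexx _).
    by case.
  exists V' => //; apply/opens_leP => F /UU'[G /UV GV [GF _]].
  have [V'' FV'' VV''] := GF V GV.
  apply: point_le WV' _; apply: point_le FV''; apply: bigjoin_ub.
  by exists (exist _ V'' VV'').
- move=> U U' V [UU' _] /opens_leP UV.
  pose W (j : {W : X | ol_le W V}) := sval j.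
  have [|V' VV' WV'] := @ol_coextend X V _ W (bigjoin (range W)) _ (lexx _).
    by case.
  exists V' => //; apply/opens_leP => F /UU'[G /UV GV [_ GF]].
  have [V'' FV'' VV''] := GF V GV.
  apply: point_le WV' _; apply: point_le FV''; apply: bigjoin_ub.
  by exists (exist _ V'' VV'').
Defined.

Definition enough_points (T : topologicalType) : Prop :=
  forall F : loc_point (opens_loc T), exists x : T, eta x = F.

Definition sober (T : topologicalType) : Prop := bijective (@eta T).

Definition spatial (X : locale) : Prop := @is_iso Loc _ _ (epsilon X).

Definition property_P (X : ordLocale) : Prop :=
  forall U V : X, ol_le U V ->
    @ol_le (opens_ol (pt_os X)) (pt_opens U) (pt_opens V).

Lemma opens_property_P (S : ordSpace) :
  open_cones S -> enough_points S -> property_P (opens_ol S).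
Proof.
move=> oS pS U V [UV VU]; split=> F.
  have [x <- {F}] := pS F => /UV[y Vy xy]; exists (eta y) => //.
  exact: (om_mono (eta_ordMap oS)).
have [x <- {F}] := pS F => /VU[y Vy xy]; exists (eta y) => //.
exact: (om_mono (eta_ordMap oS)).
Qed.

Lemma pt_open_cones (X : ordLocale) : property_P X -> open_cones (pt_os X).
Proof.
move=> PX W [U _ <-{W}]; split.
- exists (bigjoin [set V | ol_le U V]) => //; rewrite pt_setU.
  apply/seteqP; split=> F; first by move=> [V UV FV]; apply: (PX _ _ UV).2.
  by move=> [G GU [GF _]]; have [V FV UV] := GF U GU; exists V.
- exists (bigjoin [set V | ol_le V U]) => //; rewrite pt_setU.
  apply/seteqP; split=> F; first by move=> [V UV FV]; apply: (PX _ _ UV).1.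
  by move=> [G GU [_ GF]]; have [V FV UV] := GF U GU; exists V.
Qed.

Lemma pt_enough_points (X : locale) : enough_points (loc_point X).
Proof.
move=> F; exists (pt_fun (epsilon X) F); apply/point_ext/seteqP.
by split=> W; have [U ->] := pt_opensP W.
Qed.

Definition OrdTopOC : category := full_sub OrdTop open_cones.

Definition open_cones_enough_points (S : ordSpace) : Prop :=
  open_cones S /\ enough_points S.

Definition OrdTopEP : category := full_sub OrdTop open_cones_enough_points.

Definition OrdLocP : category := full_sub OrdLoc property_P.

Definition opens_functor : functor OrdTopEP OrdLocP.
Proof.
refine (@Functor OrdTopEP OrdLocP
  (fun S => exist property_P (opens_ol (sval S))
              (opens_property_P (svalP S).1 (svalP S).2))
  (fun S T g => opens_ordLocMap (svalP T).1 g) _ _).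
- by move=> S; apply: ordLocMap_ext => U; apply: opens_ext.
- by move=> S T W g f; apply: ordLocMap_ext => U; apply: opens_ext.
Defined.

Definition pt_functor : functor OrdLocP OrdTopEP.
Proof.
refine (@Functor OrdLocP OrdTopEP
  (fun X => exist open_cones_enough_points (pt_os (sval X))
              (conj (pt_open_cones (svalP X)) (@pt_enough_points (sval X))))
  (fun X Y f => pt_ordMap f) _ _).
- by move=> X; apply: ordMap_ext => F; apply: point_ext.
- by move=> X Y Z g f; apply: ordMap_ext => F; apply: point_ext.
Defined.

Definition unit_trans :
  nat_trans (functor_id OrdTopEP) (functor_comp pt_functor opens_functor).
Proof.
refine (@NatTrans OrdTopEP OrdTopEP (functor_id OrdTopEP)
  (functor_comp pt_functor opens_functor)
  (fun S => eta_ordMap (svalP S).1) _).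
by move=> S T g; apply: ordMap_ext => x; apply: point_ext.
Defined.

Definition counit_trans :
  nat_trans (functor_comp opens_functor pt_functor) (functor_id OrdLocP).
Proof.
refine (@NatTrans OrdLocP OrdLocP (functor_comp opens_functor pt_functor)
  (functor_id OrdLocP) (fun X => epsilon_ordLocMap (sval X)) _).
by move=> X Y f; apply: ordLocMap_ext => U; apply: opens_ext.
Defined.

Definition opens_pt_adjunction : adjunction opens_functor pt_functor.
Proof.
refine (@Adjunction _ _ opens_functor pt_functor unit_trans counit_trans _ _).
- by move=> S; apply: ordLocMap_ext => U; apply: opens_ext.
- by move=> X; apply: ordMap_ext => F; apply: point_ext.
Defined.

Definition sober_T0_ordered (S : OrdTopOC) : Prop :=
  sober (sval S : ordSpace) /\ T0_ordered (sval S).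

(* A sober space has enough points, so [OrdTopSober] is included both in
   [OrdTopOC] and, through [incl_OrdTopSober], in [OrdTopEP]. *)
Definition OrdTopSober : category := full_sub OrdTopOC sober_T0_ordered.

Definition spatial_P (X : ordLocale) : Prop := spatial X /\ property_P X.

Definition OrdLocSpatial : category := full_sub OrdLoc spatial_P.

Lemma sober_enough_points (T : topologicalType) : sober T -> enough_points T.
Proof. by move=> [g _ gK] F; exists (g F). Qed.

Lemma OrdTopSober_EP (S : OrdTopSober) :
  open_cones_enough_points (sval (sval S)).
Proof. exact: conj (svalP (sval S)) (sober_enough_points (svalP S).1). Qed.

Definition incl_OrdTopSober : functor OrdTopSober OrdTopEP :=
  full_lift OrdTop open_cones_enough_points
    (functor_comp (full_incl OrdTop open_cones) (full_incl OrdTopOC sober_T0_ordered))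
    OrdTopSober_EP.

Lemma OrdLocSpatial_P (X : OrdLocSpatial) : property_P (sval X).
Proof. exact: (svalP X).2. Qed.

Definition incl_OrdLocSpatial : functor OrdLocSpatial OrdLocP :=
  full_lift OrdLoc property_P (full_incl OrdLoc spatial_P) OrdLocSpatial_P.

(* Main.v *)
From HB Require Import structures.
From mathcomp Require Import all_boot all_order.
From mathcomp Require Import all_classical topology_structure.
Require Import Defs.

(** Both functors land in the smaller subcategories for free.  The space of
    points of any locale is sober, because its opens are all of the form [pt U];
    it is T0-ordered because a failure of [F <= G] is witnessed by some [U] in
    one of the two filters, and [pt U] is then a separating neighbourhood.  The
    locale of opens of any space is spatial, because the frame map
    [U |-> pt U] is inverted by taking preimages along [eta].  So the
    adjunction restricts ([sober_adjunction]), and what remains is that its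
    unit and counit are invertible as maps of ordered structures.

    On the side of spaces, [eta] is a homeomorphism when the space is sober; its
    inverse is monotone exactly because the T0-ordered condition lets opens
    detect the preorder ([eta_reflects_le], [eta_iso]).  On the side of locales,
    [epsilon] is an isomorphism of locales by spatiality; its inverse sends
    [pt U] back to [U], and is monotone because property (P) transports
    the preorder of the locale to the opens of its space of points
    ([epsilon_iso]). *)

Set Implicit Arguments.
Unset Strict Implicit.
Unset Printing Implicit Defensive.

Local Open Scope classical_set_scope.

(** The two functors pass through different proofs that an object lies in a
    subcategory; proof irrelevance makes this harmless for arrows. *)
Lemma full_sub_arrow_eq (C : category) (P : C -> Prop) (a b : C)
    (pa pa' : P a) (pb pb' : P b) (f g : hom a b) : f = g ->
  @arrow_eq (full_sub C P) (exist P a pa) (exist P b pb) f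
    (exist P a pa') (exist P b pb') g.
Proof.
by move=> <-; rewrite (Prop_irrelevance pa' pa) (Prop_irrelevance pb' pb).
Qed.

Lemma ordTop_iso (S T : ordSpace) (f : ordMap S T) (g : T -> S) :
    cancel f g -> cancel g f -> continuous g ->
    (forall x y, os_le x y -> os_le (g x) (g y)) ->
  @is_iso OrdTop S T f.
Proof.
move=> fK gK cg mg.
pose gc : continuousType T S := HB.pack g (isContinuous.Build _ _ g cg).
by exists (@OrdMap T S gc mg); split; apply: ordMap_ext => x; [apply: fK | apply: gK].
Qed.

(** Every open of the space of points is [pt U] for some [U], so a point of its
    frame of opens is determined by the set of those [U]: pushing the point
    forward along [epsilon] inverts [eta]. *)
Lemma loc_point_sober (X : locale) : sober (loc_point X).
Proof.
have eta_inj : injective (@eta (loc_point X)).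
  move=> F G FG; apply/point_ext/funext => U.
  have : eta F (pt_opens U) = eta G (pt_opens U) by rewrite FG.
  by [].
exists (pt_fun (epsilon X)) => [F|H]; first exact: point_ext.
by have [F <-] := pt_enough_points H; congr eta; apply: point_ext.
Qed.

(** If [F <= G] fails because some [U] in [F] is related to no open in [G], then
    no [H] containing [U] lies below [G], so [pt U] separates; dually for [G]. *)
Lemma pt_T0_ordered (X : ordLocale) : T0_ordered (pt_os X).
Proof.
move=> F G nFG; have [FG|] := pselect (forall U, F U -> exists2 V, G V & ol_le U V).
  have /existsNP[V /not_implyP[GV nV]] :
      ~ forall V, G V -> exists2 U, F U & ol_le U V by move=> GF; apply: nFG.
  right; exists (pt_set V); first by split=> //; apply: open_pt_set.
  by move=> [H HV [_ HF]]; apply/nV/HF.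
move=> /existsNP[U /not_implyP[FU nU]]; left.
exists (pt_set U); first by split=> //; apply: open_pt_set.
by move=> [H HU [HG _]]; apply/nU/HG.
Qed.

(** The preimage of [pt U] along [eta] is [U], in any space.  Taking preimages is
    thus a one-sided inverse of [U |-> pt U], and a two-sided one because each
    open of the space of points is a [pt U]. *)
Lemma opens_spatial (T : topologicalType) : spatial (opens_loc T).
Proof.
exists (opens_locMap (@eta T)); split; apply: locMap_ext => W.
  by have [U ->] := pt_opensP W; congr pt_opens; apply: opens_ext.
exact: opens_ext.
Qed.

(** Egli-Milner relates [U] only to opens contained in its up-set, and [V] only
    from opens contained in its down-set, so [eta x <= eta y] contradicts either
    kind of separating neighbourhood. *)
Lemma eta_reflects_le (S : ordSpace) (x y : S) : T0_ordered S ->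
  @pt_le (opens_ol S) (eta x) (eta y) -> os_le x y.
Proof.
move=> T0 [xy yx]; apply: contrapT => /T0[[U [oU Ux] nUy]|[V [oV Vy] nVx]].
  by have [W Wy [_ WU]] := xy (Opens oU) Ux; apply/nUy/WU.
by have [W Wx [WV _]] := yx (Opens oV) Vy; apply/nVx/WV.
Qed.

Lemma eta_iso (S : ordSpace) (oS : open_cones S) : sober S -> T0_ordered S ->
  @is_iso OrdTop _ _ (eta_ordMap oS).
Proof.
move=> [g etaK gK] T0; apply: (@ordTop_iso S (pt_os (opens_ol S)) _ g) => //.
  apply/continuousP => U oU; exists (Opens oU : opens S) => //.
  by apply/funext => F; rewrite -{1}[F]gK.
by move=> F G FG; apply: eta_reflects_le => //; rewrite !gK.
Qed.

(** Spatiality alone gives an inverse [g] of [epsilon] among locale morphisms.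
    As [g] sends [pt V] to [V], monotonicity of [g] first asks to extend a
    relation [ol_le U U'] along an inclusion of [U] in [V] (or of [U'] in [V]),
    which joins provide; (P) then carries the extension over to the opens of the
    space of points. *)
Lemma epsilon_iso (X : ordLocale) : spatial X -> property_P X ->
  @is_iso OrdLoc _ _ (epsilon_ordLocMap X).
Proof.
move=> [g [ge eg]] PX.
have gK (U : X) : g (pt_opens U) = U.
  exact: (congr1 (fun h : locMap X X => h U) eg).
have Kg (W : opens_loc (loc_point X)) : pt_opens (g W) = W.
  exact: (congr1 (fun h : locMap (opens_loc (loc_point X)) _ => h W) ge).
have ug : @upper_monotone X (opens_ol (pt_os X)) g.
  move=> U U' W UU' /(ol_join2 UU')[V' WV' UV'].
  by exists (pt_opens V'); rewrite ?gK // -[W]Kg; apply: PX.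
have lg : @lower_monotone X (opens_ol (pt_os X)) g.
  move=> U U' W UU' /(ol_cojoin2 UU')[V' WV' UV'].
  by exists (pt_opens V'); rewrite ?gK // -[W]Kg; apply: PX.
by exists (OrdLocMap ug lg); split; apply: ordLocMap_ext => U; [apply: Kg | apply: gK].
Qed.

Lemma opens_spatial_P (S : OrdTopSober) :
  spatial_P (sval (opens_functor (incl_OrdTopSober S))).
Proof. by split; [apply: opens_spatial | apply: svalP]. Qed.

Definition opens_sober : functor OrdTopSober OrdLocSpatial :=
  full_lift OrdLoc spatial_P
    (functor_comp (full_incl OrdLoc property_P)
      (functor_comp opens_functor incl_OrdTopSober))
    opens_spatial_P.

Definition pt_spatial_OC : functor OrdLocSpatial OrdTopOC :=
  full_lift OrdTop open_cones
    (functor_comp (full_incl OrdTop open_cones_enough_points)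
      (functor_comp pt_functor incl_OrdLocSpatial))
    (fun X => (svalP (pt_functor (incl_OrdLocSpatial X))).1).

Lemma pt_sober_T0_ordered (X : OrdLocSpatial) :
  sober_T0_ordered (pt_spatial_OC X).
Proof. by split; [apply: loc_point_sober | apply: pt_T0_ordered]. Qed.

Definition pt_spatial : functor OrdLocSpatial OrdTopSober :=
  full_lift OrdTopOC sober_T0_ordered pt_spatial_OC pt_sober_T0_ordered.

(** The components are literally those of the unit [eta] of the big adjunction,
    so that being a restriction reduces to irrelevance of membership proofs. *)
Definition sober_unit :
  nat_trans (functor_id OrdTopSober) (functor_comp pt_spatial opens_sober).
Proof.
refine (@NatTrans OrdTopSober OrdTopSober (functor_id OrdTopSober)
  (functor_comp pt_spatial opens_sober)
  (fun S => adj_unit opens_pt_adjunction (incl_OrdTopSober S)) _).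
by move=> S T g; apply: ordMap_ext => x; apply: point_ext.
Defined.

Definition spatial_counit :
  nat_trans (functor_comp opens_sober pt_spatial) (functor_id OrdLocSpatial).
Proof.
refine (@NatTrans OrdLocSpatial OrdLocSpatial
  (functor_comp opens_sober pt_spatial) (functor_id OrdLocSpatial)
  (fun X => adj_counit opens_pt_adjunction (incl_OrdLocSpatial X)) _).
by move=> X Y f; apply: ordLocMap_ext => U; apply: opens_ext.
Defined.

Definition sober_adjunction : adjunction opens_sober pt_spatial.
Proof.
refine (@Adjunction _ _ opens_sober pt_spatial sober_unit spatial_counit _ _).
- by move=> S; apply: ordLocMap_ext => U; apply: opens_ext.
- by move=> X; apply: ordMap_ext => F; apply: point_ext.
Defined.

Theorem theorem6p9 :
  restricts_to_equivalence opens_pt_adjunction incl_OrdTopSober incl_OrdLocSpatial.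
Proof.
exists opens_sober, pt_spatial, sober_adjunction; split.
  split=> [S T f|X Y g|S|X]; apply: full_sub_arrow_eq => //.
split=> [S|X].
  exact: eta_iso (svalP S).1 (svalP S).2.
exact: epsilon_iso (svalP X).1 (svalP X).2.
Qed.
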